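(* Let $d\ge 4$ be a fixed integer. For all positive integers $N$ and all integers $m\ge 2^dN$, $\mathrm{cr}_d(N,m)\in\Omega(m^2/N)$, where the implied constant depends only on $d$. In particular, for all positive integers $N$ and all integers $m\ge 0$, $$\mathrm{cr}_d(N,m)\ \ge\ \frac12\left(\frac{m^2}{(2^d-1)N}-m\right).$$
   Context: Let $\mathbb{N}=\{1,2,3,\dots\}$. For positive integers $X_1,\dots,X_d$, the $X_1\times\cdots\times X_d$ grid is the set $\{(x_1,\dots,x_d): x_i\in\{1,\dots,X_i\}\text{ for all }i\}\subset\mathbb{N}^d$; its volume is $\prod_{i=1}^d X_i$. A $d$-dimensional geometric grid graph $G$ is a finite simple graph whose vertex set is a subset of $\mathbb{N}^d$; each edge $uw$ is identified with the open straight line segment with endpoints $u$ and $w$. All geometric grid graphs are assumed to be proper: for every edge $uw\in E(G)$ and every vertex $x\in V(G)$, the point $x$ does not lie on the open segment $uw$. The volume $\mathrm{vol}(G)$ is the volume of the minimal $X_1\times\cdots\times X_d$ grid containing $V(G)$. Two distinct edges of $G$ cross (form a crossing) if, as open segments, they have a point in common; $\mathrm{cr}(G)$ is the number of crossings, i.e. of unordered pairs of distinct edges that cross. Define $\mathrm{cr}_d(N,m)=\min\{\mathrm{cr}(G): G\text{ is a }d\text{-dimensional (proper) geometric grid graph, } |E(G)|=m,\ \mathrm{vol}(G)\le N\}$ (the minimum over the empty set being $+\infty$). *)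

(* Defs.v *)
(* MathComp world, with MathComp-Analysis and finmap. *)
From HB Require Import structures.
From mathcomp Require Import all_boot all_order all_algebra.
From mathcomp Require Import finmap.
From mathcomp Require Import boolp classical_sets reals ereal.

Set Implicit Arguments.
Unset Strict Implicit.
Unset Printing Implicit Defensive.

Import Order.TTheory GRing.Theory Num.Theory.

Local Open Scope classical_set_scope.
Local Open Scope fset_scope.
Local Open Scope ring_scope.

Definition grid (d : nat) (X : 'I_d -> nat) : set 'rV[nat]_d :=
  [set x | forall i, (1 <= x ord0 i <= X i)%N].

Definition real_point (R : realType) (d : nat) (x : 'rV[nat]_d) : 'rV[R]_d :=
  map_mx (fun n : nat => n%:R) x.

Definition open_segment (R : realType) (d : nat) (a b : 'rV[R]_d) :
    set 'rV[R]_d :=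
  [set z | exists2 t : R, 0 < t < 1 & z = (1 - t) *: a + t *: b].

(* An edge is an unordered pair, i.e. a two-element set; swapping u and w
   does not change the segment. *)
Definition edge_segment (R : realType) (d : nat) (e : {fset 'rV[nat]_d}) :
    set 'rV[R]_d :=
  [set z | exists u w : 'rV[nat]_d,
     e = [fset u; w] /\ open_segment (real_point R u) (real_point R w) z].

Arguments edge_segment R {d} e.

Record grid_graph (R : realType) (d : nat) := GridGraph {
  vertices : {fset 'rV[nat]_d};
  edges : {fset {fset 'rV[nat]_d}};
  vertices_pos : forall x, x \in vertices -> forall i, (1 <= x ord0 i)%N;
  edges_simple : forall e, e \in edges -> e `<=` vertices /\ #|` e| = 2%N;
  edges_proper : forall e x, e \in edges -> x \in vertices ->
    ~ edge_segment R e (real_point R x)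
}.

(* Grids have positive sides, so the minimal grid containing the empty set is
   the 1 x ... x 1 grid. *)
Definition side (d : nat) (V : {fset 'rV[nat]_d}) (i : 'I_d) : nat :=
  maxn 1 (\max_(x <- V) x ord0 i).

Definition vol (R : realType) (d : nat) (G : grid_graph R d) : nat :=
  (\prod_(i < d) side (vertices G) i)%N.

Definition crossing (R : realType) (d : nat) (e f : {fset 'rV[nat]_d}) : Prop :=
  e != f /\ edge_segment R e `&` edge_segment R f !=set0.

Definition cr (R : realType) (d : nat) (G : grid_graph R d) : nat :=
  #|` [fset p in fpowerset (edges G) |
        `[< exists e f, p = [fset e; f] /\ crossing R e f >]]|.

(* An infimum of natural numbers: +oo if no such graph exists, and otherwise a
   minimum (see cr_min_attained). *)
Definition cr_min (R : realType) (d N m : nat) : \bar R :=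
  ereal_inf [set ((cr G)%:R)%:E | G in
    [set G : grid_graph R d | #|` edges G| = m /\ (vol G <= N)%N]].

Lemma side_grid (R : realType) (d : nat) (G : grid_graph R d) :
  ([set` vertices G] `<=` grid (side (vertices G)))%classic.
Proof.
move=> x /= xV i; rewrite (vertices_pos xV) /= leq_max.
by rewrite (leq_bigmax_seq x) ?orbT.
Qed.

Lemma side_min (d : nat) (V : {fset 'rV[nat]_d}) (X : 'I_d -> nat) :
  (forall i, 1 <= X i)%N -> ([set` V] `<=` grid X)%classic ->
  forall i, (side V i <= X i)%N.
Proof.
move=> X1 VX i; rewrite geq_max X1 /=.
by apply/bigmax_leqP_seq => x xV _; have /andP[] := VX x xV i.
Qed.

Lemma cr_min_attained (R : realType) (d N m : nat) :
  (exists G : grid_graph R d, #|` edges G| = m /\ (vol G <= N)%N) ->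
  exists G : grid_graph R d,
    [/\ #|` edges G| = m, (vol G <= N)%N & cr_min R d N m = ((cr G)%:R)%:E].
Proof.
move=> [G0 G0P].
pose P k := `[< exists G : grid_graph R d,
  [/\ #|` edges G| = m, (vol G <= N)%N & cr G = k] >].
have exP : exists k, P k by exists (cr G0); apply/asboolP; exists G0; case: G0P.
case: (ex_minnP exP) => k /asboolP[G [Gm GN Gk]] kmin.
exists G; split=> //; apply/eqP; rewrite eq_le; apply/andP; split.
  by apply: ereal_inf_lbound; exists G.
apply: le_ereal_inf_tmp => _ [H [Hm HN] <-].
rewrite lee_fin ler_nat Gk; apply: kmin.
by apply/asboolP; exists H.
Qed.

(* Main.v *)
Require Import Defs.
From HB Require Import structures.
From mathcomp Require Import all_boot all_order all_algebra.
From mathcomp Require Import finmap zify ring lra.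
From mathcomp Require Import boolp classical_sets reals ereal.

(** The proof is a pigeonhole argument on the half-integer points of the grid.
    Two distinct edges that contain the same point cross, so it is enough to
    attach to every edge one of its own points, chosen in a set of few
    candidates, and to count the collisions.

    The obvious choice, the midpoint, gives about [2 ^ d * N] candidates.  The
    factor [2 ^ d - 1] comes from avoiding the integer points: when the
    midpoint of [uw] is an integer point, replace [w] by this midpoint and
    start again ([segment_odd_half_point]).  The distance to [u] is halved each
    time, so this stops at a point [q / 2] of the edge with [q] an integer
    vector having an odd coordinate.  Such a [q] is determined by the integer
    part of [q / 2], a point of the grid, and by the set of its odd coordinates, which is
    not empty: this leaves at most [(2 ^ d - 1) * vol G] candidates
    ([half_point_code_inj], [card_half_point_codes]).

    By the Cauchy-Schwarz inequality ([card_sqr_le_collisions]), [m] edges with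
    [K] candidates yield at least [m ^ 2 / K] ordered pairs of edges with the
    same point.  Of these, [m] are diagonal, and the others count every
    crossing at most twice ([card_crossing_pairs]).  This is the explicit
    bound; for [m >= 2 ^ d * N] the subtracted [m] is at most
    [m ^ 2 / (2 ^ d * N)], which leaves a positive fraction of [m ^ 2 / N]. *)

Set Implicit Arguments.
Unset Strict Implicit.
Unset Printing Implicit Defensive.

Import Order.TTheory GRing.Theory Num.Theory.

Local Open Scope ring_scope.

(** Cauchy-Schwarz for the fibres of [f], in the form
    [2 * a * b <= a ^ 2 + b ^ 2] summed over all pairs of fibre sizes, which
    avoids division. *)
Lemma card_sqr_le_collisions (T K : finType) (f : T -> K) (S : {set K}) :
  (forall t, f t \in S) ->
  (#|T| ^ 2 <= #|S| * #|[set p : T * T | f p.1 == f p.2]|)%N.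
Proof.
move=> fS; pose n k := #|[set t | f t == k]|.
have cardT : #|T| = (\sum_(k in S) n k)%N.
  rewrite -sum1_card (partition_big f (mem S)) //=.
  by apply: eq_bigr => k _; rewrite sum1dep_card.
have cardP : #|[set p : T * T | f p.1 == f p.2]| = (\sum_(k in S) n k ^ 2)%N.
  rewrite -sum1_card (partition_big (fun p => f p.1) (mem S)) //=.
  apply: eq_bigr => k _.
  rewrite sum1dep_card expnS expn1 -cardsX; apply: eq_card => -[a b].
  rewrite !inE /=.
  by case: (f a =P k) => [->|_]; rewrite ?andbT ?andbF // eq_sym.
rewrite cardP cardT -(leq_pmul2l (isT : 0 < 2)%N).
have -> : (2 * (\sum_(k in S) n k) ^ 2 =
           \sum_(k in S) \sum_(l in S) 2 * (n k * n l))%N.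
  rewrite expnS expn1 big_distrl big_distrr /=; apply: eq_bigr => k _.
  by rewrite -!big_distrr.
have -> : (2 * (#|S| * \sum_(k in S) n k ^ 2) =
           \sum_(k in S) \sum_(l in S) (n k ^ 2 + n l ^ 2))%N.
  under [RHS]eq_bigr => k _ do rewrite big_split /= sum_nat_const.
  by rewrite big_split /= sum_nat_const -big_distrr /= mul2n addnn.
by apply: leq_sum => k _; apply: leq_sum => l _; apply: nat_Cauchy.
Qed.

(** [rowP] writes the row index as the ring element [0], which [lia] does not
    identify with [ord0]. *)
Lemma row_ord0P (T : Type) d (u v : 'rV[T]_d) :
  (forall i, u ord0 i = v ord0 i) -> u = v.
Proof. by move=> uv; apply/rowP. Qed.

(** If [u + w] has an odd coordinate, it is the required [q].  Otherwise [w] can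
    be replaced by the midpoint [v] of [uw], an integer point: the segment [uv]
    lies in [uw] and is half as long.  The bound [2 ^ n] on the distance makes
    this an induction on [n]. *)
Lemma segment_odd_half_point_rec (R : realType) d n (u w : 'rV[nat]_d) :
  u != w ->
  (forall i, u ord0 i < w ord0 i + 2 ^ n /\ w ord0 i < u ord0 i + 2 ^ n)%N ->
  exists2 q : 'rV[nat]_d, exists i, odd (q ord0 i) &
    open_segment (real_point R u) (real_point R w) (2^-1 *: real_point R q).
Proof.
elim: n w => [|n IHn] w uw near_uw.
  case/negP: uw; apply/eqP/row_ord0P => i; have := near_uw i; rewrite /=; lia.
case: (pselect (exists i, odd (u ord0 i + w ord0 i)%N)) => [[i oi]|even_uw].
  exists (\row_i (u ord0 i + w ord0 i)%N); first by exists i; rewrite mxE.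
  exists 2^-1; first lra.
  apply: row_ord0P => j; rewrite !mxE natrD; lra.
have {}even_uw i : odd (u ord0 i + w ord0 i)%N = false.
  by apply/negbTE/negP => oi; apply: even_uw; exists i.
pose v : 'rV[nat]_d := \row_i (u ord0 i + w ord0 i)./2.
have vE i : (2 * v ord0 i = u ord0 i + w ord0 i)%N.
  by rewrite mxE mul2n even_halfK ?even_uw.
have uv : u != v.
  apply: contraNneq uw => e; apply/eqP/row_ord0P => i; have := vE i.
  rewrite -e /=; lia.
case: (IHn v uv) => [i|q oq [t t01 qE]].
  have := near_uw i; have := vE i; rewrite expnS; lia.
exists q => //; exists (t / 2); first lra.
rewrite qE; apply: row_ord0P => i.
have : 2 * (v ord0 i)%:R = (u ord0 i)%:R + (w ord0 i)%:R :> R.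
  by rewrite -natrM vE natrD.
rewrite !mxE => H; nra.
Qed.

Lemma segment_odd_half_point (R : realType) d (u w : 'rV[nat]_d) :
  u != w ->
  exists2 q : 'rV[nat]_d, exists i, odd (q ord0 i) &
    open_segment (real_point R u) (real_point R w) (2^-1 *: real_point R q).
Proof.
move=> uw.
apply: (@segment_odd_half_point_rec R d (\sum_i (u ord0 i + w ord0 i))) => // i.
have := @ltn_expl 2 (\sum_i (u ord0 i + w ord0 i)) isT.
rewrite (bigD1 i) //=; lia.
Qed.

(** The bounds hold because a coordinate of a point of the segment is a convex
    combination of those of the two endpoints, which lie in the grid. *)
Lemma edge_odd_half_point (R : realType) d (G : grid_graph R d) e :
  e \in edges G ->
  exists q : 'rV[nat]_d, [/\ exists i, odd (q ord0 i),
    edge_segment R e (2^-1 *: real_point R q) &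
    forall i, (2 <= q ord0 i <= 2 * side (vertices G) i)%N].
Proof.
move=> /edges_simple[/fsubsetP eV /eqP].
rewrite cardfE -cardsT => /cards2P[[u ue] [[w we] [uw eE]]].
have {}uw : u != w by [].
have {eE}eE : e = [fset u; w]%fset.
  apply/fsetP => x; rewrite !inE; apply/idP/idP => [xe|/orP[]/eqP-> //].
  have : [` xe]%fset \in [set: e] by rewrite inE.
  by rewrite eE !inE -!val_eqE.
have [q oq qseg] := segment_odd_half_point R uw.
exists q; split=> //; first by exists u, w.
move=> i; have /andP[u1 uX] := side_grid (eV _ ue) i.
have /andP[w1 wX] := side_grid (eV _ we) i.
case: qseg => t /andP[t0 t1] /(congr1 (fun z : 'rV[R]_d => z ord0 i)); rewrite !mxE => qE.
move: u1 uX w1 wX; rewrite -!(ler_nat R) natrM => u1 uX w1 wX.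
apply/andP; split; nra.
Qed.

(** The integer part of [q / 2] and the set of its non-integer coordinates.
    Grid coordinates start at 1, whence the outer [.-1]; the bound
    [(X i).-1.+1] is [X i] in the successor form that [inord] needs. *)
Definition half_point_code d (X : 'I_d -> nat) (q : 'rV[nat]_d) :
    {dffun forall i, 'I_(X i).-1.+1} * {set 'I_d} :=
  ([ffun i => inord ((q ord0 i)./2).-1], [set i | odd (q ord0 i)]).

Lemma half_point_code_inj d (X : 'I_d -> nat) (q r : 'rV[nat]_d) :
  (forall i, 2 <= q ord0 i <= 2 * X i)%N ->
  (forall i, 2 <= r ord0 i <= 2 * X i)%N ->
  half_point_code X q = half_point_code X r -> q = r.
Proof.
move=> qX rX [/ffunP qr1 /setP qr2]; apply: row_ord0P => i.
have := qr1 i; have := qr2 i; rewrite !inE !ffunE => o /(congr1 val) /=.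
have := qX i; have := rX i => rXi qXi; rewrite !inordK; lia.
Qed.

Lemma card_half_point_codes d (X : 'I_d -> nat) :
  (forall i, 0 < X i)%N ->
  #|finset.setX [set: {dffun forall i, 'I_(X i).-1.+1}] [set~ finset.set0 : {set 'I_d}]|
    = (\prod_i X i * (2 ^ d - 1))%N.
Proof.
move=> X0; rewrite cardsX cardsT cardsC1 card_dep_ffun foldrE big_image /=.
rewrite -cardsT -powersetT card_powerset cardsT card_ord subn1; congr (_ * _)%N.
by apply: eq_bigr => i _; rewrite card_ord prednK.
Qed.

(** A crossing is an unordered pair; the order in which its two edges come is
    one bit of information, whence the factor 2. *)
Lemma card_crossing_pairs (R : realType) d (G : grid_graph R d)
    (P : {set edges G * edges G}) :
  (forall p, p \in P -> crossing R (val p.1) (val p.2)) ->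
  (#|P| <= 2 * cr G)%N.
Proof.
move=> Pcr; rewrite /cr; set C := [fset _ in _ | _]%fset.
pose g (p : edges G * edges G) := [fset val p.1; val p.2]%fset.
have gC p : p \in P -> g p \in C.
  move=> /Pcr pcr; rewrite !inE fpowersetE; apply/andP; split.
    by apply/fsubsetP => x; rewrite !inE => /orP[]/eqP->; apply: valP.
  by apply/asboolP; exists (val p.1), (val p.2).
have -> : (2 * #|` C| = #|{: C * bool}|)%N.
  by rewrite card_prod card_bool cardfE mulnC.
case: (pselect (exists c : C, True)) => [[c0 _]|C0]; last first.
  rewrite (_ : P = finset.set0) ?cards0 //; apply/setP => p; rewrite inE.
  by apply/negP => /gC pC; apply: C0; exists [` pC]%fset.
(* The bit says which of the two edges comes first in the enumeration. *)
pose h p := (insubd c0 (g p), enum_rank p.1 < enum_rank p.2)%N.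
rewrite -(@card_in_imset _ _ h P) ?max_card // => -[a b] [a' b'] pP qP.
rewrite /h => -[/(congr1 val)]; rewrite !insubdK ?gC // /g /= => gE ltE.
have aa : val a \in [fset val a'; val b']%fset by rewrite -gE fset21.
have bb : val b \in [fset val a'; val b']%fset by rewrite -gE fset22.
have [/= ab _] := Pcr _ pP.
move: aa bb ab ltE; rewrite !inE.
case/orP => /eqP/val_inj-> /orP[]/eqP/val_inj->; rewrite ?eqxx // => ne.
case: ltngtP => // /ord_inj/enum_rank_inj e _; by rewrite e eqxx in ne.
Qed.

(** The pairs of edges with the same code consist of the diagonal and of pairs
    of distinct edges through a common point, that is, of crossings. *)
Lemma edges_sqr_le_crossings (R : realType) d (G : grid_graph R d) N :
  (vol G <= N)%N ->
  (#|` edges G| ^ 2 <= N * (2 ^ d - 1) * (#|` edges G| + 2 * cr G))%N.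
Proof.
move=> volN; set X := side (vertices G).
have [q qP] := choice (fun e : edges G => edge_odd_half_point (valP e)).
pose code e := half_point_code X (q e).
set S := finset.setX [set: {dffun forall i, 'I_(X i).-1.+1}]
  [set~ finset.set0 : {set 'I_d}].
have codeS e : code e \in S.
  have [[i oi] _ _] := qP e; rewrite !inE /=.
  by apply/eqP => /setP/(_ i); rewrite !inE oi.
have cardS : (#|S| <= N * (2 ^ d - 1))%N.
  rewrite card_half_point_codes ?leq_mul2r ?volN ?orbT // => i.
  by rewrite /X /side leq_max.
rewrite cardfE; apply: leq_trans (card_sqr_le_collisions codeS) _.
apply: leq_mul cardS _.
rewrite -(cardsID [set p | p.1 == p.2]) leq_add //.
  rewrite -[X in (_ <= X)%N](card_imset predT (f := fun e => (e, e))).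
    apply: subset_leq_card; apply/fintype.subsetP => -[a b]; rewrite !inE /=.
    by case/andP => _ /eqP->; apply: imset_f.
  by move=> a b [].
apply: card_crossing_pairs => -[e f]; rewrite !inE /= => /andP[ef /eqP codeE].
split; first by apply: contra ef => /eqP/val_inj->.
have [_ qe qeX] := qP e; have [_ qf qfX] := qP f.
exists (2^-1 *: real_point R (q e)); split=> //.
by rewrite (half_point_code_inj qeX qfX codeE).
Qed.

Lemma cr_min_ge (R : realType) d N m : (1 <= d)%N -> (1 <= N)%N ->
  ((2^-1 * (m%:R ^+ 2 / ((2 ^+ d - 1) * N%:R) - m%:R))%:E
     <= cr_min R d N m)%E.
Proof.
move=> d1 N1; apply: le_ereal_inf_tmp => _ [G [<- volN] <-].
rewrite lee_fin; set m' := #|` edges G|.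
have := edges_sqr_le_crossings volN; rewrite -/m' -(ler_nat R).
rewrite natrX !natrM natrD natrM natrB ?expn_gt0 // natrX => le_m.
have D0 : 0 < (2 ^+ d - 1) * N%:R :> R.
  by rewrite mulr_gt0 ?ltr0n // subr_gt0 exprn_egt1 ?ltr1n // -lt0n.
rewrite [N%:R * _]mulrC -ler_pdivrMl // mulrC in le_m; lra.
Qed.

Theorem theorem3 (R : realType) (d : nat) (hd : (4 <= d)%N) :
  (exists2 c : R, 0 < c &
     forall N m : nat, (1 <= N)%N -> (2 ^ d * N <= m)%N ->
       ((c * (m%:R ^+ 2 / N%:R))%:E <= cr_min R d N m)%E) /\
  (forall N m : nat, (1 <= N)%N ->
     ((2^-1 * (m%:R ^+ 2 / ((2 ^+ d - 1) * N%:R) - m%:R))%:E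
        <= cr_min R d N m)%E).
Proof.
have d1 : (1 <= d)%N by apply: leq_trans hd.
split; last by move=> N m; apply: cr_min_ge.
have D1 : 1 < 2 ^+ d :> R by rewrite exprn_egt1 ?ltr1n // -lt0n.
(* With [D = 2 ^ d], the constant is half of
   [1 / (D - 1) - 1 / D = 1 / (D * (D - 1))]. *)
exists (2^-1 / (2 ^+ d * (2 ^+ d - 1))).
  by rewrite divr_gt0 ?mulr_gt0 ?invr_gt0 ?subr_gt0 //; lra.
move=> N m N1 le_m; apply: le_trans (cr_min_ge R m d1 N1).
rewrite lee_fin; set D := 2 ^+ d in D1 *.
have N0 : 0 < N%:R :> R by rewrite ltr0n.
have {}le_m : D * N%:R <= m%:R :> R by rewrite /D -natrX -natrM ler_nat.
have -> : 2^-1 / (D * (D - 1)) * (m%:R ^+ 2 / N%:R) =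
   2^-1 * (m%:R ^+ 2 / ((D - 1) * N%:R) - m%:R ^+ 2 / (D * N%:R)).
  field; lra.
rewrite ler_pM2l ?invr_gt0 ?ltr0n // lerD2l lerN2.
by rewrite ler_pdivlMr ?mulr_gt0 ?(lt_trans _ D1) // expr2 ler_wpM2l.
Qed.
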